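(* Let $\Gamma_\lambda$ be a Fuchsian Hecke triangle group ($\lambda=2\cos\frac{\pi}{q}$ with $q\in\mathbb{N}_{\ge3}$, or $\lambda\ge2$), and let $(V,\chi)$ be a finite-dimensional unitary representation of $\Gamma_\lambda$ that decomposes as a finite direct sum $\chi=\bigoplus_{j=1}^m\chi_j$ of representations $(V_j,\chi_j)$ of $\Gamma_\lambda$. Let $\mathcal{L}_{s,\chi}$ be any of the slow or fast transfer operators for $\Gamma_\lambda$ listed in the context, and $\mathcal{L}_{s,\chi_j}$ the corresponding transfer operator with $(V,\chi)$ replaced by $(V_j,\chi_j)$. Then, with respect to the decomposition of the space of $V$-valued function vectors into the direct sum of the spaces of $V_j$-valued function vectors, $$\mathcal{L}_{s,\chi}=\bigoplus_{j=1}^m\mathcal{L}_{s,\chi_j}.$$ Moreover, the Selberg zeta functions satisfy $$Z(s,\chi)=\prod_{j=1}^mZ(s,\chi_j).$$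
   Context: **Groups.** $\Gamma_\lambda\le\mathrm{PSL}_2(\mathbb{R})$ is generated by $S=\begin{bmatrix}0&1\\-1&0\end{bmatrix}$ and $T=\begin{bmatrix}1&\lambda\\0&1\end{bmatrix}$, acting by fractional linear transformations $g.z$. $\mathbb{N}=\{1,2,\dots\}$. **Selberg zeta function.** $Z(s,\chi)=\prod_{[g]\in[\Gamma_\lambda]_p}\prod_{k=0}^\infty\det\big(1-\chi(g)N(g)^{-(s+k)}\big)$ for $\mathrm{Re}\,s>\delta$, where $\delta$ is the Hausdorff dimension of the limit set of $\Gamma_\lambda$, $[\Gamma_\lambda]_p$ is the set of conjugacy classes of primitive hyperbolic elements ($g$ is primitive if it is not a proper power $h^n$, $n\ge2$, with $h\in\Gamma_\lambda$), and $N(g)$ is the square of the eigenvalue of $g$ of larger absolute value. $Z(\cdot,\chi)$ extends meromorphically to $\mathbb{C}$. **Action.** For $g=\begin{bmatrix}a&b\\c&d\end{bmatrix}$ put $j_s(g,x)=\big((cx+d)^{-2}\big)^s$ and $\tau_s(g^{-1})f(x)=j_s(g,x)f(g.x)$ for a $V$-valued function $f$, wherever this makes sense, and $\alpha_s(g)=\chi(g^{-1})\tau_s(g)$, i.e. $\alpha_s(g)f(x)=j_s(g^{-1},x)\chi(g^{-1})\big(f(g^{-1}.x)\big)$. **Transfer operators.** All of them are matrices whose entries are finite or countable sums of operators $\alpha_s(g)$, $g\in\Gamma_\lambda$, acting on vectors of $V$-valued functions. $\mathrm{Fct}(D;V)$ denotes the space of all functions $D\to V$. Blank entries are $0$. *Slow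 operators.* (S1) $\lambda=2\cos\frac{\pi}{q}<2$: with $g_k=((TS)^kS)^{-1}$, $\mathcal{L}_{s,\chi}=\sum_{k=1}^{q-1}\alpha_s(g_k)$ on $\mathrm{Fct}((0,\infty);V)$. (S2) $\lambda=2$: with $k_1=T$, $k_2=T^{-1}S$, $k_3=TS$, $k_4=S$, $$\mathcal{L}_{s,\chi}=\begin{pmatrix}\alpha_s(k_2)&0&\alpha_s(k_1^{-1})\\0&\alpha_s(k_3)&\alpha_s(k_3)\\\alpha_s(1)&\alpha_s(k_4)&0\end{pmatrix}$$ on $\mathrm{Fct}((-1,\infty);V)\times\mathrm{Fct}((-\infty,1);V)\times\mathrm{Fct}((0,\infty);V)$. (S3) $\lambda\ge2$: with $a_1=T$, $a_2=T^{-1}S$, $a_3=TS$, $$\mathcal{L}_{s,\chi}=\begin{pmatrix}\alpha_s(a_2)+\alpha_s(a_1^{-1})&\alpha_s(a_2)\\\alpha_s(a_3)&\alpha_s(a_1)+\alpha_s(a_3)\end{pmatrix}$$ on $\mathrm{Fct}((-1,\infty);V)\times\mathrm{Fct}((-\infty,1);V)$. *Fast operators* (considered on function vectors for which the series converge; they are realized on direct sums of Banach spaces $B(\mathcal{C};V)=\{f\colon\overline{\mathcal{C}}\to V\text{ continuous, holomorphic on }\mathcal{C}\}$, $\mathcal{C}$ an open disk, on which they are nuclear of order $0$ for $\mathrm{Re}\,s>\frac12$ and, for $\mathrm{Re}\,s$ large, have Fredholm determinant $\det(1-\mathcal{L}_{s,\chi})=Z(s,\chi)$). (F1) $\lambda=2\cos\frac{\pi}{q}<2$,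 acting on vectors of functions on $(\lambda,\infty)$, $(\frac1\lambda,\lambda)$, $(0,\frac1\lambda)$ (and analogously after conjugating everything by $\frac{1}{\sqrt2}\begin{bmatrix}1&-1\\1&1\end{bmatrix}$): $$\begin{pmatrix}0&\sum_{k=2}^{q-2}\alpha_s(g_k)&\sum_{n\in\mathbb{N}}\alpha_s(g_{q-1}^n)\\\sum_{n\in\mathbb{N}}\alpha_s(g_1^n)&\sum_{k=2}^{q-2}\alpha_s(g_k)&\sum_{n\in\mathbb{N}}\alpha_s(g_{q-1}^n)\\\sum_{n\in\mathbb{N}}\alpha_s(g_1^n)&\sum_{k=2}^{q-2}\alpha_s(g_k)&0\end{pmatrix}.$$ (F2) $\lambda=2$, acting on vectors of functions on $(-1,0),(0,1),(1,\infty),(-\infty,-1),(-1,0),(0,1)$ (in this order; all sums over $n\in\mathbb{N}$): $$\begin{pmatrix}&&\sum\alpha_s(k_1^{-n})&&\alpha_s(k_2)&\\\sum\alpha_s(k_2^n)&&\sum\alpha_s(k_1^{-n})&&\alpha_s(k_2)&\\\sum\alpha_s(k_2^n)&&&&\alpha_s(k_2)&\\&\alpha_s(k_3)&&&&\sum\alpha_s(k_3^n)\\&\alpha_s(k_3)&&\sum\alpha_s(k_1^n)&&\sum\alpha_s(k_3^n)\\&\alpha_s(k_3)&&\sum\alpha_s(k_1^n)&&\end{pmatrix}.$$ (F3) $\lambda>2$, acting on vectors of functions on $(-1,1),(\lambda-1,\infty),(-\infty,1-\lambda),(-1,1)$ (sums over $n\in\mathbb{N}$): $$\begin{pmatrix}\alpha_s(a_2)&\sum\alpha_s(a_1^{-n})&&\alpha_s(a_2)\\\alpha_s(a_2)&&&\alpha_s(a_2)\\\alpha_s(a_3)&&&\alpha_s(a_3)\\\alpha_s(a_3)&&\sum\alpha_s(a_1^n)&\alpha_s(a_3)\end{pmatrix}.$$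 *)

(* Defs.v *)
From HB Require Import structures.
From mathcomp Require Import all_boot all_order all_algebra.
From mathcomp Require Import finmap generic_quotient sesquilinear complex.
From mathcomp Require Import all_classical all_reals all_analysis.
From mathcomp Require Import summability.

Set Implicit Arguments.
Unset Strict Implicit.
Unset Printing Implicit Defensive.

Import Order.TTheory GRing.Theory Num.Theory.
Import numFieldNormedType.Exports.

Local Open Scope classical_set_scope.
Local Open Scope ring_scope.
Local Open Scope complex_scope.

Section SL2.
Variable R : realType.

Record SL2 := MkSL2 { sl_mx :> 'M[R]_2; _ : \det sl_mx == 1 }.

HB.instance Definition _ := [isSub for sl_mx].
HB.instance Definition _ := [Choice of SL2 by <:].

Lemma sl2_det (A : SL2) : \det A = 1.
Proof. by case: A => A /= /eqP. Qed.

Lemma sl2_one_subproof : \det (1%:M : 'M[R]_2) == 1.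
Proof. by rewrite det1. Qed.

Lemma sl2_mul_subproof (A B : SL2) : \det (sl_mx A *m sl_mx B) == 1.
Proof. by rewrite det_mulmx !sl2_det mulr1. Qed.

Lemma sl2_inv_subproof (A : SL2) : \det (\adj (sl_mx A)) == 1.
Proof.
have := congr1 determinant (mul_mx_adj (sl_mx A)).
by rewrite det_mulmx sl2_det mul1r det1 => /eqP.
Qed.

Definition sl2_one := MkSL2 sl2_one_subproof.
Definition sl2_mul A B := MkSL2 (sl2_mul_subproof A B).
Definition sl2_inv A := MkSL2 (sl2_inv_subproof A).

Definition psl_rel (A B : SL2) := (sl_mx A == sl_mx B) || (sl_mx A == - sl_mx B).

Lemma psl_rel_refl : reflexive psl_rel.
Proof. by move=> A; rewrite /psl_rel eqxx. Qed.

Lemma psl_rel_sym : symmetric psl_rel.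
Proof.
by move=> A B; rewrite /psl_rel [_ == sl_mx A]eq_sym [_ == - sl_mx A]eq_sym eqr_oppLR.
Qed.

Lemma psl_rel_trans : transitive psl_rel.
Proof.
move=> B A C; rewrite /psl_rel => /orP[]/eqP-> /orP[]/eqP->;
  by rewrite ?opprK eqxx ?orbT.
Qed.

Canonical psl_equiv := EquivRel psl_rel psl_rel_refl psl_rel_sym psl_rel_trans.

Definition PSL2 := {eq_quot psl_equiv}%qT.

HB.instance Definition _ := Choice.on PSL2.
HB.instance Definition _ := EqQuotient.on PSL2.

Definition psl_one : PSL2 := \pi_PSL2%qT sl2_one.
Definition psl_mul (g h : PSL2) : PSL2 := \pi_PSL2%qT (sl2_mul (repr g) (repr h)).
Definition psl_inv (g : PSL2) : PSL2 := \pi_PSL2%qT (sl2_inv (repr g)).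

Lemma psl_eqP (A B : SL2) :
  reflect (sl_mx A = sl_mx B \/ sl_mx A = - sl_mx B)
          (\pi_PSL2%qT A == \pi_PSL2%qT B).
Proof.
rewrite piE /=; apply: (iffP orP) => -[/eqP|/eqP]; by [left|right].
Qed.

Lemma psl_reprP (A : SL2) :
  sl_mx (repr (\pi_PSL2%qT A)) = sl_mx A \/
  sl_mx (repr (\pi_PSL2%qT A)) = - sl_mx A.
Proof. by apply/psl_eqP; rewrite reprK. Qed.

Lemma psl_pi_mul (A B : SL2) :
  psl_mul (\pi_PSL2%qT A) (\pi_PSL2%qT B) = \pi_PSL2%qT (sl2_mul A B).
Proof.
apply/eqP/psl_eqP => /=.
case: (psl_reprP A) => ->; case: (psl_reprP B) => ->;
  rewrite ?mulNmx ?mulmxN ?opprK; by [left|right].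
Qed.

Lemma psl_pi_inv (A : SL2) :
  psl_inv (\pi_PSL2%qT A) = \pi_PSL2%qT (sl2_inv A).
Proof.
have adjE (B : SL2) : \adj (sl_mx B) = invmx (sl_mx B).
  by rewrite /invmx unitmxE sl2_det unitr1 invr1 scale1r.
apply/eqP/psl_eqP => /=; rewrite !adjE.
case: (psl_reprP A) => ->; [by left|right].
by rewrite -[invmx (- _)]/(GRing.inv (- sl_mx A)) invrN.
Qed.


Lemma psl_mulA : associative psl_mul.
Proof.
elim/quotW => A; elim/quotW => B; elim/quotW => C.
rewrite (psl_pi_mul B C) (psl_pi_mul A B) !psl_pi_mul; congr (\pi_PSL2%qT _).
by apply: val_inj; rewrite /= mulmxA.
Qed.

Lemma psl_mul1g : left_id psl_one psl_mul.
Proof.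
elim/quotW => A; rewrite psl_pi_mul; congr (\pi_PSL2%qT _).
by apply: val_inj; rewrite /= mul1mx.
Qed.

Lemma psl_mulg1 : right_id psl_one psl_mul.
Proof.
elim/quotW => A; rewrite psl_pi_mul; congr (\pi_PSL2%qT _).
by apply: val_inj; rewrite /= mulmx1.
Qed.

Lemma psl_mulVg : left_inverse psl_one psl_inv psl_mul.
Proof.
elim/quotW => A; rewrite psl_pi_inv psl_pi_mul; congr (\pi_PSL2%qT _).
by apply: val_inj; rewrite /= mul_adj_mx sl2_det.
Qed.

Lemma psl_mulgV : right_inverse psl_one psl_inv psl_mul.
Proof.
elim/quotW => A; rewrite psl_pi_inv psl_pi_mul; congr (\pi_PSL2%qT _).
by apply: val_inj; rewrite /= mul_mx_adj sl2_det.
Qed.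

HB.instance Definition _ :=
  isGroup.Build PSL2 psl_mulA psl_mul1g psl_mulg1 psl_mulVg psl_mulgV.

Definition mx22 (a b c d : R) : 'M[R]_2 :=
  \matrix_(i, j) (if i == 0 then (if j == 0 then a else b)
                  else (if j == 0 then c else d)).

Lemma det_mx22 a b c d : \det (mx22 a b c d) = a * d - b * c.
Proof.
rewrite (expand_det_row _ 0) !big_ord_recl big_ord0 /cofactor !det_mx11 !mxE /=.
by rewrite expr0 mul1r expr1 mulN1r mulrN addr0.
Qed.

Lemma psl_S_subproof : \det (mx22 0 1 (- 1) 0) == 1.
Proof. by rewrite det_mx22 mul0r mul1r sub0r opprK. Qed.

Lemma psl_T_subproof lam : \det (mx22 1 lam 0 1) == 1.
Proof. by rewrite det_mx22 mulr1 mulr0 subr0. Qed.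

Lemma psl_cayley_subproof :
  \det ((Num.sqrt 2)^-1 *: mx22 1 (- 1) 1 1) == 1.
Proof.
by rewrite detZ det_mx22 !mulr1 opprK exprVn sqr_sqrtr ?ler0n// mulVf//.
Qed.

Definition psl_S : PSL2 := \pi_PSL2%qT (MkSL2 psl_S_subproof).
Definition psl_T (lam : R) : PSL2 := \pi_PSL2%qT (MkSL2 (psl_T_subproof lam)).
Definition psl_cayley : PSL2 := \pi_PSL2%qT (MkSL2 psl_cayley_subproof).

End SL2.

Section Hecke.
Variable R : realType.
Local Notation C := R[i].
Implicit Types (lam : R) (g h : PSL2 R) (s z : C).

Local Notation S := (psl_S R).
Local Notation T := (psl_T).

Definition hecke_parameter lam : Prop :=
  (exists2 q : nat, (3 <= q)%N & lam = 2 * cos (pi / q%:R)) \/ 2 <= lam.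

Inductive hecke lam : PSL2 R -> Prop :=
| hecke_S : hecke lam S
| hecke_T : hecke lam (T lam)
| hecke_1 : hecke lam 1%g
| hecke_mul g h : hecke lam g -> hecke lam h -> hecke lam (g * h)%g
| hecke_inv g : hecke lam g -> hecke lam g^-1%g.

(* [repr g] is one of the two matrices representing g; everything computed
   from it below is invariant under changing its sign. *)
Definition mnum g z : C := (sl_mx (repr g) 0 0)%:C * z + (sl_mx (repr g) 0 1)%:C.
Definition mden g z : C := (sl_mx (repr g) 1 0)%:C * z + (sl_mx (repr g) 1 1)%:C.
Definition moebius g z : C := mnum g z / mden g z.

(* Principal branch of complex powers. *)
Definition cexp z : C :=
  (expR (complex.Re z))%:C * (cos (complex.Im z) +i* sin (complex.Im z)).
Definition cabs z : R := complex.Re `|z|.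
Definition carg z : R :=
  let t := acos (complex.Re z / cabs z) in if 0 <= complex.Im z then t else - t.
Definition cpow z s : C := cexp (s * (ln (cabs z) +i* carg z)).

Definition jfactor s g z : C := cpow (mden g z ^- 2) s.

(* Convergence of complex sequences; R[i]^o carries the norm topology. *)
Definition ccvg (u : nat -> C) (l : C) : Prop :=
  (u : nat -> R[i]^o) @ \oo --> (l : R[i]^o).

Section FiniteDimensional.
Variable V : vectType C.
Local Notation e := (vbasis {:V}).

Definition vcvg (u : nat -> V) (l : V) : Prop :=
  forall i, ccvg (fun n => coord e i (u n)) (coord e i l).
Definition vlim (u : nat -> V) : V := xget 0 [set l | vcvg u l].
Definition endo_det (f : 'End(V)) : C := \det (passmx.mxof e e f).
End FiniteDimensional.

Definition is_representation lam (V : vectType C) (chi : PSL2 R -> 'End(V)) :=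
  chi 1%g = \1%VF /\
  forall g h, hecke lam g -> hecke lam h -> chi (g * h)%g = (chi g \o chi h)%VF.

Definition is_unitary_representation lam (V : vectType C)
    (form : {dot V for (@Num.conj C)}) (chi : PSL2 R -> 'End(V)) :=
  is_representation lam chi /\ forall g, hecke lam g -> isometry form form (chi g).

Definition is_direct_sum lam (V : vectType C) (chi : PSL2 R -> 'End(V))
    (m : nat) (W : 'I_m -> vectType C) (psi : forall j, PSL2 R -> 'End(W j))
    (iota : forall j, 'Hom(W j, V)) : Prop :=
  bijective (fun w : forall j, W j => \sum_j iota j (w j)) /\
  forall g, hecke lam g ->
    forall j (w : W j), chi g (iota j w) = iota j (psi j g w).

Inductive term := One of PSL2 R | Powers of PSL2 R.

HB.instance Definition _ := gen_eqMixin term.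

(* [One g] stands for alpha_s(g) and [Powers g] for the sum over n >= 1 of
   alpha_s(g^n). An entry of the matrix is the list of its summands. The
   functions live on subsets of the complex plane, and every group element acts
   through its conjugate by [opm_conj]. *)
Record operator_matrix := OperatorMatrix {
  opm_conj : PSL2 R;
  opm_dom : seq (set C);
  opm_rows : seq (seq (seq term)) }.

Definition opm_size A := size (opm_dom A).
Definition opm_domain A (r : 'I_(opm_size A)) : set C := nth set0 (opm_dom A) r.
Definition opm_entry A (r c : 'I_(opm_size A)) : seq term :=
  nth [::] (nth [::] (opm_rows A) r) c.

Definition fvec n (D : 'I_n -> set C) (V : Type) := forall r, D r -> V.

Section Operator.
Variables (A : operator_matrix) (D : 'I_(opm_size A) -> set C) (s : C).

Section Value.
Variables (V : vectType C) (chi : PSL2 R -> 'End(V)).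

Definition alpha g (f : C -> V) (x : C) : V :=
  let k := (opm_conj A * g^-1 * (opm_conj A)^-1)%g in
  jfactor s k x *: chi g^-1%g (f (moebius k x)).

Definition power_sums g (f : C -> V) (x : C) (n : nat) : V :=
  \sum_(1 <= k < n.+1) alpha (g ^+ k)%g f x.

Definition term_converges (t : term) (f : C -> V) (x : C) : Prop :=
  if t is Powers g then exists l, vcvg (power_sums g f x) l else True.

Definition term_value (t : term) (f : C -> V) (x : C) : V :=
  match t with
  | One g => alpha g f x
  | Powers g => vlim (power_sums g f x)
  end.

(* ['valL_ 0 f] is f extended by 0 outside its domain; the elements acting in
   the entry (r, c) of the operators below map domain r into domain c. *)
Definition transfer_dom (F : fvec D V) : Prop :=
  forall r c (x : D r) t, t \in opm_entry r c ->
    term_converges t ('valL_ 0 (F c)) (val x).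

Definition transfer (F : fvec D V) : fvec D V := fun r x =>
  \sum_c \sum_(t <- opm_entry r c) term_value t ('valL_ 0 (F c)) (val x).
End Value.
End Operator.

Definition fsum n (D : 'I_n -> set C) (V : vectType C) (m : nat)
    (W : 'I_m -> vectType C) (iota : forall j, 'Hom(W j, V))
    (F : forall j, fvec D (W j)) : fvec D V :=
  fun r x => \sum_j iota j (F j r x).

(* The space of V-valued function vectors is the direct sum of the spaces of
   W_j-valued ones (the latter embedded by composition with iota_j), and the
   partially defined operator is the direct sum of its analogues for psi_j. *)
Definition operator_decomposes (A : operator_matrix)
    (D : 'I_(opm_size A) -> set C) s
    (V : vectType C) (chi : PSL2 R -> 'End(V)) (m : nat)
    (W : 'I_m -> vectType C) (psi : forall j, PSL2 R -> 'End(W j))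
    (iota : forall j, 'Hom(W j, V)) : Prop :=
  [/\ bijective (fsum iota : (forall j, fvec D (W j)) -> fvec D V),
      forall F : forall j, fvec D (W j),
        transfer_dom s chi (fsum iota F) <->
        forall j, transfer_dom s (psi j) (F j)
    & forall F : forall j, fvec D (W j),
        (forall j, transfer_dom s (psi j) (F j)) ->
        transfer s chi (fsum iota F) =
        fsum iota (fun j => transfer s (psi j) (F j))].

Definition real_set (i : interval R) : set C := [set x%:C | x in [set` i]].

Definition slow1 q lam : operator_matrix :=
  let g k := ((T lam * S) ^+ k * S)^-1%g in
  OperatorMatrix 1%g [:: real_set `]0, +oo[ ]
    [:: [:: [seq One (g k) | k <- iota 1 q.-1] ] ].

Definition slow2 : operator_matrix :=
  let k1 := T 2 in let k2 := ((T 2)^-1 * S)%g in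
  let k3 := (T 2 * S)%g in let k4 := S in
  OperatorMatrix 1%g
    [:: real_set `](-1), +oo[; real_set `]-oo, 1[; real_set `]0, +oo[ ]
    [:: [:: [:: One k2]; [::];        [:: One k1^-1%g] ];
        [:: [::];        [:: One k3]; [:: One k3] ];
        [:: [:: One 1%g]; [:: One k4]; [::] ] ].

Definition slow3 lam : operator_matrix :=
  let a1 := T lam in let a2 := ((T lam)^-1 * S)%g in let a3 := (T lam * S)%g in
  OperatorMatrix 1%g [:: real_set `](-1), +oo[; real_set `]-oo, 1[ ]
    [:: [:: [:: One a2; One a1^-1%g]; [:: One a2] ];
        [:: [:: One a3];              [:: One a1; One a3] ] ].

(* [conj] is 1 or the Cayley-type matrix by which everything is conjugated. *)
Definition fast1 (conj : PSL2 R) q lam : operator_matrix :=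
  let g k := ((T lam * S) ^+ k * S)^-1%g in
  let mid := [seq One (g k) | k <- iota 2 (q - 3)] in
  OperatorMatrix conj
    [:: moebius conj @` real_set `]lam, +oo[;
        moebius conj @` real_set `]lam^-1, lam[;
        moebius conj @` real_set `]0, lam^-1[ ]
    [:: [:: [::];                  mid; [:: Powers (g q.-1)] ];
        [:: [:: Powers (g 1%N)];   mid; [:: Powers (g q.-1)] ];
        [:: [:: Powers (g 1%N)];   mid; [::] ] ].

Definition fast2 : operator_matrix :=
  let k1 := T 2 in let k2 := ((T 2)^-1 * S)%g in let k3 := (T 2 * S)%g in
  OperatorMatrix 1%g
    [:: real_set `](-1), 0[; real_set `]0, 1[; real_set `]1, +oo[;
        real_set `]-oo, (-1)[; real_set `](-1), 0[; real_set `]0, 1[ ]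
    [:: [:: [::]; [::]; [:: Powers k1^-1%g]; [::]; [:: One k2]; [::] ];
        [:: [:: Powers k2]; [::]; [:: Powers k1^-1%g]; [::]; [:: One k2]; [::] ];
        [:: [:: Powers k2]; [::]; [::]; [::]; [:: One k2]; [::] ];
        [:: [::]; [:: One k3]; [::]; [::]; [::]; [:: Powers k3] ];
        [:: [::]; [:: One k3]; [::]; [:: Powers k1]; [::]; [:: Powers k3] ];
        [:: [::]; [:: One k3]; [::]; [:: Powers k1]; [::]; [::] ] ].

Definition fast3 lam : operator_matrix :=
  let a1 := T lam in let a2 := ((T lam)^-1 * S)%g in let a3 := (T lam * S)%g in
  OperatorMatrix 1%g
    [:: real_set `](-1), 1[; real_set `](lam - 1), +oo[;
        real_set `]-oo, (1 - lam)[; real_set `](-1), 1[ ]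
    [:: [:: [:: One a2]; [:: Powers a1^-1%g]; [::]; [:: One a2] ];
        [:: [:: One a2]; [::]; [::]; [:: One a2] ];
        [:: [:: One a3]; [::]; [::]; [:: One a3] ];
        [:: [:: One a3]; [::]; [:: Powers a1]; [:: One a3] ] ].

Inductive slow_operator lam : operator_matrix -> Prop :=
| SlowCompact q of (3 <= q)%N & lam = 2 * cos (pi / q%:R) :
    slow_operator lam (slow1 q lam)
| SlowTheta of lam = 2 : slow_operator lam slow2
| SlowFunnel of 2 <= lam : slow_operator lam (slow3 lam).

Inductive fast_operator lam : operator_matrix -> Prop :=
| FastCompact q of (3 <= q)%N & lam = 2 * cos (pi / q%:R) :
    fast_operator lam (fast1 1%g q lam)
| FastCompactDisk q of (3 <= q)%N & lam = 2 * cos (pi / q%:R) :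
    fast_operator lam (fast1 (psl_cayley R) q lam)
| FastTheta of lam = 2 : fast_operator lam fast2
| FastFunnel of 2 < lam : fast_operator lam (fast3 lam).

Definition diameter (U : set R) : \bar R :=
  ereal_sup ([set 0%E] `|` [set `|p.1 - p.2|%:E | p in U `*` U]).

Definition hausdorff_content (d eps : R) (E : set R) : \bar R :=
  ereal_inf [set (\sum_(i <oo) (diameter (U i) `^ d))%E | U in
    [set U : nat -> set R | E `<=` \bigcup_i U i /\
                            forall i, (diameter (U i) <= eps%:E)%E]].

Definition hausdorff_measure (d : R) (E : set R) : \bar R :=
  ereal_sup [set hausdorff_content d eps E | eps in [set eps : R | 0 < eps]].

(* Leaving out d = 0 does not change the infimum. *)
Definition hausdorff_dim (E : set R) : R :=
  inf [set d : R | 0 < d /\ hausdorff_measure d E = 0%E].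

(* The limit set without the point at infinity, which does not affect the
   dimension: the orbits lie in the upper half plane, so their accumulation
   points on the real line are the real points of their closures. *)
Definition limit_set lam : set R :=
  [set x | exists2 z : C, 0 < complex.Im z &
    forall eps : R, 0 < eps ->
      exists2 g, hecke lam g & cabs (moebius g z - x%:C) < eps].

Definition hyperbolic g : Prop := 2 < `|\tr (sl_mx (repr g))|.

Definition primitive lam g : Prop :=
  ~ exists h n, [/\ hecke lam h, (2 <= n)%N & g = (h ^+ n)%g].

Definition gnorm g : R :=
  xget 0 [set a | eigenvalue (sl_mx (repr g)) a /\
    forall b, eigenvalue (sl_mx (repr g)) b -> `|b| <= `|a|] ^+ 2.

Definition prim_hyp_classes lam : set (set (PSL2 R)) :=
  [set c | exists g, [/\ hecke lam g, hyperbolic g, primitive lam g &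
                         c = [set (h * g * h^-1)%g | h in hecke lam]]].

Definition euler_factor (V : vectType C) (chi : PSL2 R -> 'End(V)) s g (k : nat) : C :=
  endo_det (\1%VF - cpow (gnorm g)%:C (- (s + k%:R)) *: chi g)%R.

(* Unconditional convergence of the product of f to l. *)
Definition cvg_prod (I : choiceType) (f : I -> C) (l : C) : Prop :=
  (fun J : {fset I} => \prod_(i : J) f (val i) : R[i]^o) @ totally --> (l : R[i]^o).

(* The inner product does not depend on the representative g of the class c. *)
Definition selberg_product lam (V : vectType C) (chi : PSL2 R -> 'End(V)) s (l : C) :=
  exists P : prim_hyp_classes lam -> C,
    (forall (c : prim_hyp_classes lam) g, val c g ->
       ccvg (fun n => \prod_(k < n) euler_factor chi s g k) (P c)) /\
    cvg_prod P l.

(* Holomorphic near z0, in the form of a convergent power series. *)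
Definition analytic_at (f : C -> C) (z0 : C) : Prop :=
  exists (a : nat -> C) (r : R), 0 < r /\
    forall z, cabs (z - z0) < r ->
      ccvg (fun n => \sum_(k < n) a k * (z - z0) ^+ k) (f z).

Definition pole_at (f : C -> C) (z0 : C) : Prop :=
  exists (h : C -> C) (n : nat) (r : R),
    [/\ analytic_at h z0, h z0 != 0, (0 < n)%N, 0 < r &
        forall z, 0 < cabs (z - z0) < r -> f z = h z / (z - z0) ^+ n].

(* Values at poles are arbitrary; elsewhere they are those of the holomorphic
   function, so two such functions are equal as meromorphic functions when they
   agree outside the poles. *)
Definition meromorphic (f : C -> C) : Prop :=
  forall z, analytic_at f z \/ pole_at f z.

(* By the identity theorem this determines Z outside its poles. *)
Definition is_selberg_zeta lam (V : vectType C) (chi : PSL2 R -> 'End(V))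
    (Z : C -> C) : Prop :=
  meromorphic Z /\
  forall s, hausdorff_dim (limit_set lam) < complex.Re s ->
    selberg_product lam chi s (Z s).

End Hecke.

(* Main.v *)
Require Import Defs.
From HB Require Import structures.
From mathcomp Require Import all_boot all_order all_algebra.
From mathcomp Require Import sesquilinear complex.
From mathcomp Require Import all_classical all_reals all_analysis.
From mathcomp Require Import finmap summability ring lra.

(* Let pi_j be the projections of the direct sum. Every summand alpha_s(g) of a
   transfer operator has g in the Hecke group, hence commutes with the iota_j;
   the series over powers of g follow because linear maps between
   finite-dimensional spaces are continuous.
   For the zeta functions, 1 - a chi(g) = 1 + \sum_j P_j with
   P_j = iota_j (- a psi_j(g)) pi_j and P_j P_k = 0 for j <> k, so its determinant
   is \prod_j det(1 + P_j), and det(1 + P_j) = det(1 - a psi_j(g)) by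
   det(1 + A B) = det(1 + B A). Uniqueness of limits gives Z = \prod_j Z_j on the
   half-plane of convergence. The difference of the two sides is meromorphic on
   the plane, and each point has a punctured neighbourhood on which it is either
   identically zero or nowhere zero; by connectedness the first case always
   holds. Where all Z_j are analytic, their product is bounded, so Z has no pole
   there and the values agree. *)

Import Order.TTheory GRing.Theory Num.Theory.
Import numFieldNormedType.Exports.

Local Open Scope classical_set_scope.
Local Open Scope ring_scope.
Local Open Scope complex_scope.

(** * Direct sums and determinants *)

Section DirectSum.
Context {F : fieldType} {V : vectType F} {m : nat} {W : 'I_m -> vectType F}.
Variable iota : forall j, 'Hom(W j, V).

(** The inverse of a bijective linear map is linear, so its components serve as projections. A
    single vector [iota j w] is recognised as the image of the family supported at [j], built with
    [dfwith]. *)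
Lemma direct_sum_projections :
  bijective (fun w : forall j, W j => \sum_j iota j (w j)) ->
  exists pi : forall j, 'Hom(V, W j),
    [/\ forall j w, pi j (iota j w) = w,
        forall j k w, j != k -> pi k (iota j w) = 0
      & forall v, \sum_j iota j (pi j v) = v].
Proof.
case=> g gK sK.
have glin j : linear (fun v => g v j).
  move=> a u v; pose h k := a *: g u k + g v k.
  suff -> : a *: u + v = \sum_k iota k (h k) by rewrite gK.
  rewrite -[u in LHS]sK -[v in LHS]sK scaler_sumr -big_split /=.
  by apply: eq_bigr => k _; rewrite linearP.
pose L j : {linear V -> W j} :=
  HB.pack (fun v => g v j) (GRing.isLinear.Build _ _ _ _ _ (glin j)).
have giota j w : iota j w = \sum_k iota k (dfwith (fun k => 0 : W k) j w k).
  rewrite (bigD1 j) //= dfwithin big1 ?addr0 // => k /negPf kj.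
  by rewrite dfwithout 1?eq_sym ?kj // linear0.
exists (fun j => linfun (L j)); split => [j w|j k w jk|v].
- by rewrite lfunE /= giota gK dfwithin.
- by rewrite lfunE /= giota gK dfwithout.
- by rewrite -[RHS]sK; apply: eq_bigr => j _; rewrite lfunE.
Qed.

End DirectSum.

(** * Determinants of 1 plus mutually annihilating summands *)

Section Determinant.
Context {F : fieldType}.

(** Multiplying [M] by the unipotent block matrix [N] on the left or on the right gives a block
    triangular matrix; both products have the determinant of [M]. *)
Lemma det_add1_mulmxC p q (A : 'M[F]_(p, q)) (B : 'M[F]_(q, p)) :
  \det (1%:M + A *m B) = \det (1%:M + B *m A).
Proof.
pose M := block_mx 1%:M (- A) B 1%:M.
pose N := block_mx 1%:M A 0 1%:M.
have NM : N *m M = block_mx (1%:M + A *m B) 0 B 1%:M.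
  by rewrite mulmx_block !mul1mx !mul0mx !mulmx1 !add0r addNr.
have MN : M *m N = block_mx 1%:M 0 B (1%:M + B *m A).
  by rewrite mulmx_block !mulmx1 !mulmx0 !addr0 mul1mx subrr addrC.
have dN : \det N = 1 by rewrite det_ublock !det1 mulr1.
have := congr1 determinant NM; rewrite det_mulmx det_lblock dN det1 mul1r mulr1.
by have := congr1 determinant MN; rewrite det_mulmx det_lblock dN det1 mul1r mulr1 => -> ->.
Qed.

(** The cross terms vanish when [1 + P i] is multiplied by 1 plus the sum over the remaining
    indices; [uniq s] ensures that these differ from [i]. *)
Lemma det_add1_sum (I : eqType) n (s : seq I) (P : I -> 'M[F]_n) :
  uniq s -> (forall i j, i != j -> P i *m P j = 0) ->
  \det (1%:M + \sum_(i <- s) P i) = \prod_(i <- s) \det (1%:M + P i).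
Proof.
move=> + P0; elim: s => [|i s IH] /=; first by rewrite !big_nil addr0 det1.
case/andP=> si us; rewrite !big_cons -IH // -det_mulmx.
congr (\det _); rewrite mulmxDl mul1mx mulmxDr mulmx1 mulmx_sumr.
rewrite [X in _ = _ + (_ + X)]big1_seq ?addr0 => [|j /andP[_ js]].
  by rewrite -addrA [P i + _]addrC.
by apply: P0; apply: contraNneq si => ->.
Qed.

End Determinant.

Section DetDirectSum.
Import passmx.

(** Since the maps [iota j \o pi j] add up to the identity, [f] is 1 plus the sum of the
    [iota j \o (h j - \1) \o pi j]. *)
Lemma det_mxof_direct_sum {F : fieldType} (V : vectType F) m (W : 'I_m -> vectType F)
    (iota : forall j, 'Hom(W j, V)) (f : 'End(V)) (h : forall j, 'End(W j)) :
  bijective (fun w : forall j, W j => \sum_j iota j (w j)) ->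
  (forall j w, f (iota j w) = iota j (h j w)) ->
  \det (mxof (vbasis {:V}) (vbasis {:V}) f) =
  \prod_j \det (mxof (vbasis {:W j}) (vbasis {:W j}) (h j)).
Proof.
move=> /direct_sum_projections[pi [piK pi0 iotaK]] fiota.
have bV (U : vectType F) : basis_of {:U} (vbasis {:U}) by apply: vbasisP.
pose mx (U U' : vectType F) (k : 'Hom(U, U')) := mxof (vbasis {:U}) (vbasis {:U'}) k.
have mx1 (U : vectType F) : mx U U \1%VF = 1%:M.
  by rewrite /mx mxof1 // (basis_free (bV U)).
(* Matrices act on row vectors, so composition reverses the order of the factors. *)
have mxM (U U' U'' : vectType F) (a : 'Hom(U, U')) (b : 'Hom(U', U'')) :
  mx _ _ (b \o a)%VF = mx _ _ a *m mx _ _ b by exact: (mxof_comp _ _ (bV U')).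
have mxD (U U' : vectType F) (a b : 'Hom(U, U')) : mx _ _ (a + b) = mx _ _ a + mx _ _ b.
  exact: (linearD (mxof _ _)).
have mxS (U U' : vectType F) (I : finType) (a : I -> 'Hom(U, U')) :
  mx _ _ (\sum_i a i) = \sum_i mx _ _ (a i) by exact: (linear_sum (mxof _ _)).
(* Moving [mx (iota j)] to the front by [det_add1_mulmxC] puts it next to [mx (pi j)], where the two
   cancel. *)
have hE j : \det (mx _ _ (h j)) = \det (1%:M + mx _ _ (iota j \o (h j - \1) \o pi j)%VF).
  rewrite !mxM mulmxA det_add1_mulmxC mulmxA -mxM.
  suff -> : (pi j \o iota j)%VF = \1%VF.
    by rewrite mx1 mul1mx -mx1 -mxD addrC subrK.
  by apply/lfunP => w; rewrite !lfunE /= piK.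
under eq_bigr do rewrite -/(mx _ _ _) hE.
rewrite -(@det_add1_sum _ _ _ _ (fun j => mx _ _ _)).
- rewrite -mxS -mx1 -mxD; congr (\det (mx _ _ _)).
  apply/lfunP => v; rewrite lfunE /= lfunE /= sum_lfunE.
  rewrite -[v in LHS]iotaK -[v in RHS]iotaK linear_sum -big_split /=.
  apply: eq_bigr => j _.
  by do ! rewrite lfunE /=; rewrite iotaK fiota linearB /= [RHS]addrC subrK.
- exact: index_enum_uniq.
- move=> i j ij; rewrite -mxM.
  set k := (X in mx _ _ X); suff -> : k = 0 by exact: (linear0 (mxof _ _)).
  by apply/lfunP => v; rewrite /k; do ! rewrite lfunE /=; rewrite pi0 // linear0 subrr linear0.
Qed.

End DetDirectSum.

(** * Transfer operators *)

Section Limits.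
Context {R : realType}.
Local Notation C := R[i].

Lemma ccvg_unique (u : nat -> C) (l k : C) : ccvg u l -> ccvg u k -> l = k.
Proof. by move=> ul uk; apply: (cvg_unique (@norm_hausdorff _ C^o) ul uk). Qed.

Lemma ccvg_sum (I : Type) (r : seq I) (u : I -> nat -> C) (l : I -> C) :
  (forall i, ccvg (u i) (l i)) ->
  ccvg (fun n => \sum_(i <- r) u i n) (\sum_(i <- r) l i).
Proof.
by move=> ul; apply: (@cvg_big C^o) => [|i _]; [exact: add_continuous|exact: ul].
Qed.

Lemma ccvg_prod (I : Type) (r : seq I) (u : I -> nat -> C) (l : I -> C) :
  (forall i, ccvg (u i) (l i)) ->
  ccvg (fun n => \prod_(i <- r) u i n) (\prod_(i <- r) l i).
Proof.
by move=> ul; apply: (@cvg_big C^o) => [|i _]; [exact: mul_continuous|exact: ul].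
Qed.

Lemma vcvg_unique (V : vectType C) (u : nat -> V) l k : vcvg u l -> vcvg u k -> l = k.
Proof.
move=> ul uk; rewrite (coord_vbasis (memvf l)) (coord_vbasis (memvf k)).
by apply: eq_bigr => i _; rewrite (ccvg_unique _ _ _ (ul i) (uk i)).
Qed.

Lemma vlimE (V : vectType C) (u : nat -> V) l : vcvg u l -> vlim u = l.
Proof. by move=> ul; apply: xget_unique => // k uk; exact: vcvg_unique uk ul. Qed.

Lemma vcvg_sum (V : vectType C) (I : Type) (r : seq I) (u : I -> nat -> V) l :
  (forall i, vcvg (u i) (l i)) ->
  vcvg (fun n => \sum_(i <- r) u i n) (\sum_(i <- r) l i).
Proof.
move=> ul i; rewrite linear_sum; under eq_fun do rewrite linear_sum.
by apply: ccvg_sum => j; exact: ul.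
Qed.

(** Each coordinate of [f v] is a fixed linear combination of the coordinates of [v], and [vcvg] is
    coordinatewise. *)
Lemma vcvg_linear (U V : vectType C) (f : 'Hom(U, V)) (u : nat -> U) l :
  vcvg u l -> vcvg (fun n => f (u n)) (f l).
Proof.
have fE v i : coord (vbasis {:V}) i (f v) = \sum_j coord (vbasis {:U}) j v *
    coord (vbasis {:V}) i (f (vbasis {:U})`_j).
  rewrite {1}(coord_vbasis (memvf v)) !linear_sum.
  by apply: eq_bigr => j _; rewrite !linearZ.
move=> ul i; rewrite fE; under eq_fun do rewrite fE.
apply: ccvg_sum => j; apply: cvgM; [exact: ul|exact: cvg_cst].
Qed.

End Limits.

(** * Splitting the operators summand by summand *)

Section Decomposition.
Context {R : realType} (lam : R).
Local Notation C := R[i].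

Lemma hecke_expg (g : PSL2 R) n : hecke lam g -> hecke lam (g ^+ n)%g.
Proof.
move=> hg; elim: n => [|n IH]; first by rewrite expg0; exact: hecke_1.
by rewrite expgS; exact: hecke_mul.
Qed.

Definition term_elt (t : term R) := match t with One g => g | Powers g => g end.

Section Summands.
Context {V : vectType C} (chi : PSL2 R -> 'End(V)) {m : nat} {W : 'I_m -> vectType C}.
Context (psi : forall j, PSL2 R -> 'End(W j)) (iota : forall j, 'Hom(W j, V)).
Hypothesis iota_sum : is_direct_sum lam chi psi iota.

Section Pointwise.
Variables (A : operator_matrix R) (s : C) (f : C -> V) (h : forall j, C -> W j).
Hypothesis fE : forall z, f z = \sum_j iota j (h j z).

(** The factor [jfactor] is a scalar and the point is moved independently of the representation, so
    only [chi g^-1] has to pass through [iota j]. *)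
Lemma alpha_direct_sum g x : hecke lam g ->
  alpha A s chi g f x = \sum_j iota j (alpha A s (psi j) g (h j) x).
Proof.
case: iota_sum => _ chi_iota /hecke_inv hg.
rewrite /alpha fE linear_sum scaler_sumr; apply: eq_bigr => j _.
by rewrite linearZ /= chi_iota.
Qed.

Lemma power_sums_direct_sum g x n : hecke lam g ->
  power_sums A s chi g f x n = \sum_j iota j (power_sums A s (psi j) g (h j) x n).
Proof.
move=> hg; rewrite /power_sums.
under [RHS]eq_bigr do rewrite linear_sum.
rewrite [RHS]exchange_big; apply: eq_bigr => k _.
exact/alpha_direct_sum/hecke_expg.
Qed.

Lemma power_sums_vcvg g x l : hecke lam g ->
  (forall j, vcvg (power_sums A s (psi j) g (h j) x) (l j)) ->
  vcvg (power_sums A s chi g f x) (\sum_j iota j (l j)).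
Proof.
move=> hg hl.
have -> : power_sums A s chi g f x =
    fun n => \sum_j iota j (power_sums A s (psi j) g (h j) x n).
  by apply/funext => n; exact: power_sums_direct_sum.
by apply: vcvg_sum => j; exact: vcvg_linear.
Qed.

(** Applying the continuous projection [pi j] to a convergent series isolates the j-th one;
    conversely the images of the limits add up. *)
Lemma term_converges_direct_sum t x : hecke lam (term_elt t) ->
  term_converges A s chi t f x <->
  forall j, term_converges A s (psi j) t (h j) x.
Proof.
case: t => //= g hg; split=> [[l fl] j|hl].
  case: iota_sum => /direct_sum_projections[pi [piK pi0 _]] _.
  exists (pi j l); have := vcvg_linear _ _ (pi j) _ _ fl.
  congr vcvg; apply/funext => n; rewrite power_sums_direct_sum // linear_sum /=.
  by rewrite (bigD1 j) //= piK big1 ?addr0 // => k kj; rewrite pi0.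
exists (\sum_j iota j (sval (cid (hl j)))).
by apply: power_sums_vcvg => // j; case: cid.
Qed.

Lemma term_value_direct_sum t x : hecke lam (term_elt t) ->
  (forall j, term_converges A s (psi j) t (h j) x) ->
  term_value A s chi t f x = \sum_j iota j (term_value A s (psi j) t (h j) x).
Proof.
case: t => /= g hg; first by move=> _; exact: alpha_direct_sum.
move=> hl; pose l j := sval (cid (hl j)).
have lP j : vcvg (power_sums A s (psi j) g (h j) x) (l j) by rewrite /l; case: cid.
rewrite (vlimE _ _ _ (power_sums_vcvg g x l hg lP)).
by apply: eq_bigr => j _; rewrite (vlimE _ _ _ (lP j)).
Qed.

End Pointwise.

(** Supplies the hypothesis [fE] for functions extended by 0: outside the domain both sides
    vanish. *)
Lemma valL_fsum n (D : 'I_n -> set C) (F : forall j, fvec D (W j)) c z :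
  'valL_ 0 ((fsum iota F : fvec D V) c) z = \sum_j iota j ('valL_ 0 (F j c) z).
Proof.
rewrite /= oinv_set_val; case: (insub z) => [y|] //=.
by rewrite big1 // => j _; rewrite linear0.
Qed.

Lemma fsum_bij n (D : 'I_n -> set C) :
  bijective (fsum iota : (forall j, fvec D (W j)) -> fvec D V).
Proof.
case: iota_sum => /direct_sum_projections[pi [piK pi0 iotaK]] _.
exists (fun F j r x => pi j (F r x)) => F; last first.
  by apply: functional_extensionality_dep => r; apply/funext => x; exact: iotaK.
apply: functional_extensionality_dep => j.
apply: functional_extensionality_dep => r; apply/funext => x.
rewrite linear_sum (bigD1 j) //= piK big1 ?addr0 // => k kj; exact: pi0.
Qed.

(** With all group elements in the Hecke group every summand splits, and the finite sums over
    columns, terms and [j] are interchanged. The domains [D] are arbitrary in order to cover slow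
    and fast operators alike. *)
Lemma operator_decomposes_hecke (A : operator_matrix R)
    (D : 'I_(opm_size A) -> set C) s :
  (forall r c t, t \in @opm_entry _ A r c -> hecke lam (term_elt t)) ->
  operator_decomposes D s chi psi iota.
Proof.
move=> hA; split=> [|F|F hF]; first exact: fsum_bij.
  split=> [hF j r c x t tA|hF r c x t tA].
    by have /(term_converges_direct_sum _ _ _ _ (valL_fsum _ _ F c))
      := hF r c x t tA; apply; exact: hA tA.
  apply/(term_converges_direct_sum _ _ _ _ (valL_fsum _ _ F c)); first exact: hA tA.
  by move=> j; exact: hF.
apply: functional_extensionality_dep => r; apply/funext => x.
rewrite /transfer /fsum; under [RHS]eq_bigr do rewrite linear_sum.
rewrite [RHS]exchange_big; apply: eq_bigr => c _.
under [RHS]eq_bigr do rewrite linear_sum.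
rewrite [RHS]exchange_big big_seq [RHS]big_seq; apply: eq_bigr => t tA.
apply: (term_value_direct_sum _ _ _ _ (valL_fsum _ _ F c)); first exact: hA tA.
by move=> j; exact: hF.
Qed.

End Summands.

Lemma opm_entry_all (A : operator_matrix R) (p : pred (term R)) :
  all (all (all p)) (opm_rows A) ->
  forall r c t, t \in @opm_entry _ A r c -> p t.
Proof.
move=> Ap r c t; rewrite /opm_entry.
(* Beyond the listed rows, and below beyond the listed columns, [nth] returns the empty list, which
   has no members. *)
have [rlt|rge] := ltnP r (size (opm_rows A)); last by rewrite !nth_default.
move/all_nthP: Ap => /(_ [::] r rlt).
set row := nth _ _ r => rowp.
have [clt|cge] := ltnP c (size row); last by rewrite nth_default.
by move/all_nthP: rowp => /(_ [::] c clt) /allP; apply.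
Qed.

(** A boolean form of membership, so that [all] can be evaluated on the explicit lists of
    entries. *)
Let in_hecke (t : term R) := `[< hecke lam (term_elt t) >].

Let in_hecke_intro t : hecke lam (term_elt t) -> in_hecke t.
Proof. by move=> ht; apply/asboolP. Qed.

Local Ltac hecke_words := repeat
  (apply: hecke_S || apply: hecke_T || apply: hecke_1 || apply: hecke_expg ||
   apply: hecke_mul || apply: hecke_inv).

Local Ltac hecke_entries :=
  rewrite /= ?all_cat ?all_map ?andbT;
  repeat lazymatch goal with
  | |- is_true (_ && _) => apply/andP; split
  | |- is_true (all _ _) => apply/allP => ? _
  end; first [done | by apply: in_hecke_intro => /=; hecke_words].

Lemma slow_operator_hecke (A : operator_matrix R) : slow_operator lam A ->
  forall r c t, t \in @opm_entry _ A r c -> hecke lam (term_elt t).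
Proof.
move=> hA r c t tA; apply/asboolP; move: r c t tA.
apply: (@opm_entry_all A in_hecke); case: hA => [q _ _|lam2|_].
- by hecke_entries.
(* The entries are words in [T 2], the generators of the group involve [T lam]. *)
- by rewrite /slow2 -lam2; hecke_entries.
- by hecke_entries.
Qed.

Lemma fast_operator_hecke (A : operator_matrix R) : fast_operator lam A ->
  forall r c t, t \in @opm_entry _ A r c -> hecke lam (term_elt t).
Proof.
move=> hA r c t tA; apply/asboolP; move: r c t tA.
apply: (@opm_entry_all A in_hecke); case: hA => [q _ _|q _ _|lam2|_].
- by hecke_entries.
- by hecke_entries.
- by rewrite /fast2 -lam2; hecke_entries.
- by hecke_entries.
Qed.

End Decomposition.

(** * Power series and the identity theorem *)

Section ComplexAbs.
Context {R : realType}.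
Local Notation C := R[i].
Implicit Types (x y z : C).

Lemma cabsE z : `|z| = (cabs z)%:C.
Proof. by rewrite /cabs normc_def. Qed.

Lemma cabs_ge0 z : 0 <= cabs z.
Proof. by rewrite -lecR -cabsE; exact: normr_ge0. Qed.

Lemma cabs_real (a : R) : cabs a%:C = `|a|.
Proof. by rewrite /cabs normc_def /= expr0n addr0 sqrtr_sqr. Qed.

Lemma cabs0 : cabs (0 : C) = 0.
Proof. by apply: complexI; rewrite -cabsE normr0. Qed.

Lemma cabs_eq0 z : (cabs z == 0) = (z == 0).
Proof.
rewrite -[z == 0]normr_eq0 cabsE; apply/eqP/eqP => [->//|].
by move=> h; apply: complexI; rewrite h.
Qed.

Lemma cabs_gt0 z : (0 < cabs z) = (z != 0).
Proof. by rewrite lt0r cabs_eq0 cabs_ge0 andbT. Qed.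

Lemma cabsM x y : cabs (x * y) = cabs x * cabs y.
Proof. by apply: complexI; rewrite rmorphM /= -!cabsE normrM. Qed.

Lemma cabsX x n : cabs (x ^+ n) = cabs x ^+ n.
Proof. by apply: complexI; rewrite rmorphXn /= -!cabsE normrX. Qed.

Lemma cabsN x : cabs (- x) = cabs x.
Proof. by apply: complexI; rewrite -!cabsE normrN. Qed.

Lemma cabsB x y : cabs (x - y) = cabs (y - x).
Proof. by rewrite -cabsN opprB. Qed.

Lemma cabsD x y : cabs (x + y) <= cabs x + cabs y.
Proof. by rewrite -lecR rmorphD /= -!cabsE ler_normD. Qed.

Lemma cabs_triangle y x z : cabs (x - z) <= cabs (x - y) + cabs (y - z).
Proof. by rewrite -lecR rmorphD /= -!cabsE ler_distD. Qed.

Lemma cabs_sum (I : Type) (r : seq I) (P : pred I) (u : I -> C) :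
  cabs (\sum_(i <- r | P i) u i) <= \sum_(i <- r | P i) cabs (u i).
Proof.
elim/big_ind2 : _ => [|x a y b xa yb|//]; first by rewrite cabs0.
by rewrite (le_trans (cabsD _ _)) // lerD.
Qed.

Lemma ler_Re_cabs z : `|complex.Re z| <= cabs z.
Proof. by rewrite -lecR -cabsE normc_ge_Re. Qed.

Lemma ccvgP (u : nat -> C) l : ccvg u l <->
  forall eps : R, 0 < eps -> exists N, forall n, (N <= n)%N -> cabs (l - u n) < eps.
Proof.
split=> [/cvgrPdist_lt ul eps eps0|ul].
  have /ul[N _ hN] : 0 < eps%:C by rewrite ltcR.
  by exists N => n /hN /=; rewrite cabsE ltcR.
(* A complex number above 0 has zero imaginary part, so a real bound suffices. *)
apply/cvgrPdist_lt => -[e e'] /=; rewrite ltcE /= => /andP[/eqP -> e0].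
have [N hN] := ul _ e0; exists N => // n /= /hN.
by rewrite -ltcR -cabsE.
Qed.

Lemma ccvg_le (u : nat -> C) l (B : R) N :
  ccvg u l -> (forall n, (N <= n)%N -> cabs (u n) <= B) -> cabs l <= B.
Proof.
move=> /ccvgP ul uB; apply/ler_addgt0Pr => eps eps0; have [K hK] := ul _ eps0.
rewrite -[l](subrK (u (maxn N K))) addrC (le_trans (cabsD _ _)) // lerD //.
  by rewrite uB ?leq_maxl.
by rewrite ltW // hK ?leq_maxr.
Qed.

Lemma ccvg_geometric (u v : nat -> C) l (B : R) :
  ccvg u l -> (forall n, cabs (u n - v n) <= B / 2 ^+ n) -> ccvg v l.
Proof.
move=> /ccvgP ul uv; apply/ccvgP => eps eps0.
have [N hN] := ul _ (divr_gt0 eps0 (ltr0Sn R 1)).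
(* For n at least [K] one has [B * 2 / eps < K <= n < 2 ^ n]. A negative [B] is treated apart
   because [archi_boundP] needs a nonnegative argument. *)
pose K := Num.bound (B * 2 / eps); exists (maxn N K) => n.
rewrite geq_max => /andP[Nn Kn].
rewrite (le_lt_trans (cabs_triangle (u n) _ _)) // [ltRHS]splitr ltr_leD ?hN //.
rewrite (le_trans (uv n)) // ler_pdivrMr ?exprn_gt0 // mulrAC ler_pdivlMr //.
rewrite -ler_pdivrMl // mulrC.
have [B0|B0] := ltP (B * 2) 0.
  rewrite (@le_trans _ _ 0) ?exprn_ge0 //.
  by rewrite mulr_le0_ge0 ?invr_ge0 // ltW.
apply/ltW/(lt_le_trans (archi_boundP _)); first by rewrite divr_ge0 // ltW.
by rewrite -natrX ler_nat ltnW // (leq_ltn_trans Kn) // ltn_expl.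
Qed.

End ComplexAbs.

(** * Power series with coefficient bounds *)

Section PowerSeries.
Context {R : realType}.
Local Notation C := R[i].
Implicit Types (f h : C -> C) (a b : nat -> C) (z w : C).

(** The Cauchy-type bound [M] is kept with the radius so that tails compare with geometric
    series. *)
Definition power_series_on a (M r : R) f z0 :=
  [/\ 0 < r, forall k, cabs (a k) * r ^+ k <= M
    & forall w, cabs w < r -> ccvg (fun n => \sum_(k < n) a k * w ^+ k) (f (z0 + w))].

(** Convergence at the single point [z0 + q] bounds the partial sums there, and each term is a
    difference of two consecutive partial sums. *)
Lemma analytic_power_series f z0 :
  analytic_at f z0 -> exists a M r, power_series_on a M r f z0.
Proof.
case=> a [r [r0 ha]]; pose q := r / 2.
have q0 : 0 < q by rewrite divr_gt0.
have qr : q < r by rewrite /q ltr_pdivrMr // mulrDr mulr1 ltrDl.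
have := ha (z0 + q%:C); rewrite addrAC subrr add0r cabs_real gtr0_norm // => /(_ qr).
set u := (fun n => _); set l := f _ => ul.
have /ccvgP/(_ 1 ltr01)[N hN] := ul.
(* From [N] on the partial sums are within 1 of [l]; the finitely many earlier ones are covered by
   adding them all. *)
pose B := cabs l + 1 + \sum_(i < N) cabs (u i).
have uB n : cabs (u n) <= B.
  have [Nn|nN] := leqP N n; last first.
    rewrite /B (bigD1 (Ordinal nN)) //= addrCA lerDl addr_ge0 //.
      by rewrite addr_ge0 ?cabs_ge0.
    by apply: sumr_ge0 => i _; exact: cabs_ge0.
  rewrite /B -[u n](subrK l) (le_trans (cabsD _ _)) // cabsB addrC -addrA lerD //.
  rewrite ler_wpDr //; first by apply: sumr_ge0 => i _; exact: cabs_ge0.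
  exact/ltW/hN.
exists a, (B + B), q; split=> [//|k|w wq].
  have -> : cabs (a k) * q ^+ k = cabs (u k.+1 - u k).
    rewrite /u big_ord_recr /= addrAC subrr add0r cabsM cabsX cabs_real.
    by rewrite ger0_norm ?(ltW q0).
  by rewrite (le_trans (cabsD _ _)) // cabsN lerD.
by have := ha (z0 + w); rewrite addrAC subrr add0r; apply; exact: lt_trans qr.
Qed.

Lemma power_series_shrink a M r q f z0 : 0 < q -> q <= r ->
  power_series_on a M r f z0 -> power_series_on a M q f z0.
Proof.
move=> q0 qr [r0 aM ha]; split=> [//|k|w wq]; last exact/ha/(lt_le_trans wq).
rewrite (le_trans _ (aM k)) // ler_wpM2l ?cabs_ge0 //.
by apply: lerXn2r => //; rewrite nnegrE ltW.
Qed.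

Lemma power_series_bound_ge0 a M r f z0 : power_series_on a M r f z0 -> 0 <= M.
Proof.
by case=> r0 /(_ 0%N) + _; apply: le_trans; rewrite mulr_ge0 ?cabs_ge0.
Qed.

Lemma power_series_coef a M r f z0 k :
  power_series_on a M r f z0 -> cabs (a k) <= M / r ^+ k.
Proof. by case=> r0 aM _; rewrite ler_pdivlMr ?exprn_gt0. Qed.

Lemma power_series_tail a M r f z0 m w :
  power_series_on a M r f z0 -> cabs w <= r / 2 ->
  cabs (f (z0 + w) - \sum_(k < m) a k * w ^+ k) <= 2 * M * (cabs w / r) ^+ m.
Proof.
move=> fa w2; have M0 := power_series_bound_ge0 _ _ _ _ _ fa.
case: (fa) => r0 aM ha.
pose t := cabs w / r.
have t0 : 0 <= t by rewrite divr_ge0 ?cabs_ge0 ?ltW.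
have t2 : 2 * t <= 1 by rewrite mulrC /t mulrAC ler_pdivrMr // mul1r -ler_pdivlMr.
have wr : cabs w < r.
  by rewrite (le_lt_trans w2) // ltr_pdivrMr // mulrDr mulr1 ltrDl.
have term k : cabs (a k * w ^+ k) <= M * t ^+ k.
  rewrite cabsM cabsX /t expr_div_n mulrA mulrAC.
  by rewrite ler_wpM2r ?exprn_ge0 ?cabs_ge0 ?(power_series_coef _ _ _ _ _ _ fa).
(* The subtracted power makes the induction close: [2 * t <= 1] gives
   [t ^ k <= 2 * (t ^ k - t ^ k.+1)]. *)
have partial d : cabs (\sum_(k < m + d) a k * w ^+ k - \sum_(k < m) a k * w ^+ k)
    <= M * (2 * (t ^+ m - t ^+ (m + d))).
  elim: d => [|d IH]; first by rewrite addn0 !subrr cabs0 !mulr0.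
  rewrite addnS big_ord_recr /= addrAC (le_trans (cabsD _ _)) //.
  rewrite (le_trans (lerD IH (term _))) // -mulrDr ler_wpM2l //.
  have := ler_wpM2r (exprn_ge0 (m + d) t0) t2; rewrite exprS.
  lra.
apply: (@ccvg_le _ (fun n => \sum_(k < n) a k * w ^+ k - \sum_(k < m) a k * w ^+ k) _ _ m).
  by apply: cvgB; [exact: ha|exact: cvg_cst].
move=> n /subnKC <-; rewrite (le_trans (partial _)) // -/t.
rewrite [2 * M]mulrC -mulrA ler_wpM2l // ler_wpM2l // gerBl.
exact: exprn_ge0.
Qed.

(* If a_m is the first nonzero coefficient, then |f(z0 + w) - a_m w^m| <= K |w|^(m+1)
   for small w. *)
Lemma analytic_isolated_zeros f z0 :
  analytic_at f z0 -> (exists2 d : R, 0 < d & forall w, cabs w < d -> f (z0 + w) = 0) \/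
  exists2 d : R, 0 < d & forall w, 0 < cabs w < d -> f (z0 + w) != 0.
Proof.
case/analytic_power_series => a [M [r fa]].
have M0 := power_series_bound_ge0 _ _ _ _ _ fa.
case: (fa) => r0 _ ha.
have [a0|/existsNP[k0 /eqP ak0]] := pselect (forall k, a k = 0).
  left; exists r => [//|w /ha hw]; apply: (ccvg_unique _ _ _ hw).
  rewrite (_ : (fun n => _) = cst 0); first exact: cvg_cst.
  by apply/funext => n; rewrite big1 // => k _; rewrite a0 mul0r.
right; case: (@ex_minnP (fun k => a k != 0)); first by exists k0.
move=> m am min_m.
pose K := 2 * M / r ^+ m.+1.
have K0 : 0 <= K by rewrite divr_ge0 ?mulr_ge0 ?exprn_ge0 // ltW.
(* The first bound permits the tail estimate, the second makes [K * cabs w] smaller than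
   [cabs (a m)]; adding 1 avoids division by 0. *)
exists (Num.min (r / 2) (cabs (a m) / (K + 1))).
  by rewrite lt_min !divr_gt0 ?cabs_gt0 // ltr_wpDl.
move=> w /andP[w0]; rewrite lt_min => /andP[/ltW wr wK].
apply: contraTneq wK => fw; rewrite -leNgt.
have := power_series_tail _ _ _ _ _ m.+1 _ fa wr.
rewrite fw sub0r cabsN big_ord_recr /= big1 ?add0r => [|k _]; last first.
  suff -> : a k = 0 by rewrite mul0r.
  by apply: contraTeq (ltn_ord k) => /min_m; rewrite -leqNgt.
rewrite cabsM cabsX expr_div_n mulrA mulrAC -/K exprSr mulrA mulrAC.
rewrite ler_pM2r ?exprn_gt0 // => amK.
rewrite ler_pdivrMr ?ltr_wpDl // (le_trans amK) // mulrDr mulr1 mulrC lerDl.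
exact: cabs_ge0.
Qed.

(** Carries an identity known off the centre to the centre itself. A nonvanishing punctured disc is
    refuted at a point at half the smaller radius. *)
Lemma analytic_eq0 f z0 : analytic_at f z0 ->
  (exists2 d : R, 0 < d & forall w, 0 < cabs w < d -> f (z0 + w) = 0) -> f z0 = 0.
Proof.
case/analytic_isolated_zeros => [[d d0 fd] _|[d d0 fd] [e e0 fe]].
  by have := fd 0; rewrite addr0 cabs0; exact.
pose w : C := (Num.min d e / 2)%:C.
have de : 0 < Num.min d e by rewrite lt_min d0.
have cw : cabs w = Num.min d e / 2 by rewrite cabs_real gtr0_norm ?divr_gt0.
have w0 : 0 < cabs w by rewrite cw divr_gt0.
have : cabs w < Num.min d e by rewrite cw ltr_pdivrMr // mulrDr mulr1 ltrDl.
rewrite lt_min => /andP[wd we].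
by have := fd w; rewrite w0 wd fe ?w0 ?we // eqxx => /(_ isT).
Qed.

Lemma analytic_sub f h z0 :
  analytic_at f z0 -> analytic_at h z0 -> analytic_at (fun z => f z - h z) z0.
Proof.
case=> a [r [r0 fa]] [b [q [q0 hb]]].
exists (fun k => a k - b k), (Num.min r q); split; first by rewrite lt_min r0.
move=> z; rewrite lt_min => /andP[zr zq].
rewrite (_ : (fun n => _) = fun n => \sum_(k < n) a k * (z - z0) ^+ k -
    \sum_(k < n) b k * (z - z0) ^+ k); first exact: cvgB (fa _ zr) (hb _ zq).
by apply/funext => n; rewrite -sumrB; apply: eq_bigr => k _; rewrite mulrBl.
Qed.

Lemma analytic_Xn z0 n : analytic_at (fun z => (z - z0) ^+ n) z0.
Proof.
exists (fun k => (k == n)%:R), 1; split=> [|z _]; first exact: ltr01.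
apply/ccvgP => eps eps0; exists n.+1 => N nN.
rewrite (bigD1 (Ordinal nN)) //= eqxx mul1r big1 ?addr0 ?subrr ?cabs0 // => k kn.
by rewrite (negPf (_ : (k : nat) != n)) ?mul0r.
Qed.

(* Cauchy product: for |w| <= r/8 the k-th term is at most (k + 1) 8^-k <= 4^-k
   up to a constant, so the product of the n-th partial sums misses the n-th
   partial sum of the product by terms summing to at most n 4^-n <= 2^-n. *)
Lemma analytic_mul f h z0 :
  analytic_at f z0 -> analytic_at h z0 -> analytic_at (fun z => f z * h z) z0.
Proof.
case/analytic_power_series => a [M [r' fa]] /analytic_power_series[b [N [q' hb]]].
pose r := Num.min r' q'.
have r0 : 0 < r by rewrite lt_min; case: fa => -> _ _; case: hb => ->.
have {}fa : power_series_on a M r f z0.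
  by apply: power_series_shrink fa; rewrite ?ge_min ?lexx.
have {}hb : power_series_on b N r h z0.
  by apply: power_series_shrink hb; rewrite ?ge_min ?lexx ?orbT.
have M0 := power_series_bound_ge0 _ _ _ _ _ fa.
have N0 := power_series_bound_ge0 _ _ _ _ _ hb.
pose c k := \sum_(j < k.+1) a j * b (k - j)%N.
exists c, (r / 8); split=> [|z]; first by rewrite divr_gt0.
set w := z - z0 => wr8; have -> : z = z0 + w by rewrite subrKC.
have wr : cabs w < r.
  by rewrite (lt_le_trans wr8) // ler_pdivrMr // ler_peMr ?ler1n // ltW.
have fhw : ccvg (fun n => (\sum_(k < n) a k * w ^+ k) * (\sum_(k < n) b k * w ^+ k))
    (f (z0 + w) * h (z0 + w)).
  by case: fa => _ _ /(_ _ wr) fw; case: hb => _ _ /(_ _ wr); exact: cvgM.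
apply: (ccvg_geometric _ _ _ (M * N) fhw) => n.
(* Truncations turn the product of partial sums into a polynomial value: below degree [n] the
   coefficients of [P * Q] are the [c k], and the error is the block of degrees from [n] on. *)
pose P := \poly_(k < n) a k; pose Q := \poly_(k < n) b k.
have sumE (d : nat -> C) : \sum_(k < n) d k * w ^+ k = (\poly_(k < n) d k).[w].
  by rewrite horner_poly.
have PQw : (P * Q).[w] = \sum_(k < n + n) (P * Q)`_k * w ^+ k.
  apply: horner_coef_wide; rewrite (leq_trans (size_polyMleq _ _)) //.
  by rewrite (leq_trans (leq_pred _)) // leq_add ?size_poly.
have PQk k : cabs ((P * Q)`_k * w ^+ k) <= M * N / 4 ^+ k.
  have PQ : cabs (P * Q)`_k <= k.+1%:R * (M * N / r ^+ k).
    rewrite coefM (le_trans (cabs_sum _ _ _ _)) //.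
    rewrite mulr_natl -[X in _ *+ X]card_ord -sumr_const ler_sum // => j _.
    have jk : r ^+ k = r ^+ j * r ^+ (k - j) by rewrite -exprD subnKC // -ltnS.
    rewrite cabsM jk invfM mulrACA ler_pM ?cabs_ge0 // coef_poly; case: ifP => _;
      rewrite ?cabs0 ?divr_ge0 ?exprn_ge0 ?(ltW r0) //.
      exact: power_series_coef fa.
    exact: power_series_coef hb.
  have wk : cabs w ^+ k <= (r / 8) ^+ k.
    by apply: lerXn2r (ltW wr8); rewrite nnegrE ?cabs_ge0 // divr_ge0 // ltW.
  rewrite cabsM cabsX.
  apply: le_trans (ler_pM (cabs_ge0 _) (exprn_ge0 _ (cabs_ge0 _)) PQ wk) _.
  have -> : k.+1%:R * (M * N / r ^+ k) * (r / 8) ^+ k =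
      M * N / 4 ^+ k * (k.+1%:R / 2 ^+ k).
    rewrite (_ : 8 = 4 * 2) ?expr_div_n ?exprMn; last by rewrite -natrM.
    by field; rewrite !expf_neq0 //; rewrite gt_eqF.
  rewrite ler_piMr ?divr_ge0 ?mulr_ge0 ?exprn_ge0 // ler_pdivrMr ?exprn_gt0 //.
  by rewrite mul1r -natrX ler_nat ltn_expl.
rewrite !sumE -hornerM -/P -/Q PQw big_split_ord /= horner_poly addrAC.
rewrite -sumrB big1 ?add0r => [|i _]; last first.
  rewrite coefM /c (eq_bigr (fun j : 'I_i.+1 => a j * b (i - j)%N)) ?subrr // => j _.
  have ji : (j <= i)%N by rewrite -ltnS.
  by rewrite !coef_poly (leq_ltn_trans ji) // (leq_ltn_trans (leq_subr _ _)).
rewrite (le_trans (cabs_sum _ _ _ _)) //.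
have PQn (i : 'I_n) : cabs ((P * Q)`_(n + i) * w ^+ (n + i)) <= M * N / 4 ^+ n.
  rewrite (le_trans (PQk _)) // ler_wpM2l ?mulr_ge0 //.
  by rewrite lef_pV2 ?posrE ?exprn_gt0 // ler_weXn2l ?leq_addr // ler1n.
rewrite (le_trans (ler_sum _ (fun i _ => PQn i))) // sumr_const card_ord -[_ *+ n]mulr_natr.
have -> : M * N / 4 ^+ n * n%:R = M * N / 2 ^+ n * (n%:R / 2 ^+ n).
  rewrite (_ : 4 = 2 * 2) ?exprMn; last by rewrite -natrM.
  by field; rewrite expf_neq0.
rewrite ler_piMr ?divr_ge0 ?mulr_ge0 ?exprn_ge0 // ler_pdivrMr ?exprn_gt0 //.
by rewrite mul1r -natrX ler_nat ltnW // ltn_expl.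
Qed.

Lemma analytic_prod (I : Type) (s : seq I) (f : I -> C -> C) z0 :
  (forall i, analytic_at (f i) z0) -> analytic_at (fun z => \prod_(i <- s) f i z) z0.
Proof.
move=> fi; elim: s => [|i s IH].
  (* The empty product is the constant 1, a zeroth power. *)
  by under eq_fun do rewrite big_nil; exact: (analytic_Xn z0 0).
by under eq_fun do rewrite big_cons; exact: analytic_mul.
Qed.

End PowerSeries.

(** * Meromorphic functions and connectedness *)

Section Identity.
Context {R : realType}.
Local Notation C := R[i].
Implicit Types (f h : C -> C) (z w : C) (A : set C).

(** The centre is left out because values at poles are arbitrary. *)
Definition punctured A z0 := exists2 d : R, 0 < d & forall w, 0 < cabs w < d -> A (z0 + w).

Lemma puncturedP A z0 : punctured A z0 <->
  exists2 d : R, 0 < d & forall z, 0 < cabs (z - z0) < d -> A z.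
Proof.
split=> -[d d0 Ad]; exists d => // z zd.
  by have := Ad _ zd; rewrite subrKC.
by apply: Ad; rewrite addrAC subrr add0r.
Qed.

Lemma puncturedI A B z0 : punctured A z0 -> punctured B z0 -> punctured (A `&` B) z0.
Proof.
case=> d d0 Ad [e e0 Be]; exists (Num.min d e); first by rewrite lt_min d0.
move=> w; rewrite lt_min => /and3P[w0 wd we].
by split; [apply: Ad; rewrite w0|apply: Be; rewrite w0].
Qed.

Lemma punctured_nonempty A z0 : punctured A z0 -> A !=set0.
Proof.
case=> d d0 Ad; exists (z0 + (d / 2)%:C); apply: Ad.
rewrite cabs_real gtr0_norm ?divr_gt0 //=.
by rewrite ltr_pdivrMr // mulrDr mulr1 ltrDl.
Qed.

Lemma punctured_near A z0 : punctured A z0 ->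
  exists2 d : R, 0 < d & forall z, cabs (z - z0) < d -> punctured A z.
Proof.
move/puncturedP => [d d0 Ad]; exists d => // z zd.
have [->|zz0] := eqVneq z z0; first by apply/puncturedP; exists d.
have z0z : 0 < cabs (z - z0) by rewrite cabs_gt0 subr_eq0.
(* The first bound stays inside the given disc, the second keeps [z0] outside the new one. *)
apply/puncturedP; exists (Num.min (d - cabs (z - z0)) (cabs (z - z0))).
  by rewrite lt_min subr_gt0 zd.
move=> w; rewrite lt_min => /and3P[_ wd wz]; apply: Ad; apply/andP; split.
  have := cabs_triangle w z z0; rewrite (cabsB z w) => h.
  by rewrite -(ltrD2l (cabs (w - z))) addr0 (lt_le_trans wz).
by rewrite (le_lt_trans (cabs_triangle z _ _)) // -ltrBrDr.
Qed.

(** Along the real line through [p] and [q] the preimage of [P] is open, closed and contains 0,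
    hence is everything, as the real line is connected. *)
Lemma segment_induction (P Q : set C) p q :
  (forall z, P z -> exists2 d : R, 0 < d & forall w, cabs (w - z) < d -> P w) ->
  (forall z, Q z -> exists2 d : R, 0 < d & forall w, cabs (w - z) < d -> Q w) ->
  (forall z, P z \/ Q z) -> P `&` Q = set0 -> P p -> P q.
Proof.
move=> Po Qo PQ PQ0 Pp.
pose g (t : R) := p + t%:C * (q - p).
have g_open (A : set C) :
    (forall z, A z -> exists2 d : R, 0 < d & forall w, cabs (w - z) < d -> A w) ->
    open (g @^-1` A).
  move=> Ao; rewrite openE => t /Ao[d d0 Ad].
  (* [g] is Lipschitz with constant [cabs (q - p)]; adding 1 keeps the divisor positive when
     [p = q]. *)
  have c1 : 0 < cabs (q - p) + 1 by rewrite ltr_wpDl ?cabs_ge0.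
  apply/nbhs_ballP; exists (d / (cabs (q - p) + 1)); first exact: divr_gt0.
  move=> u; rewrite /ball /= ltr_pdivlMr // => tu; apply: Ad.
  rewrite /g opprD addrACA subrr add0r -mulrBl -rmorphB cabsM cabs_real distrC.
  by rewrite (le_lt_trans _ tu) // ler_wpM2l // lerDl.
have : g @^-1` P = setT.
  have /connected_intervalP : is_interval (setT : set R) by [].
  apply.
  - by exists 0; rewrite /= /g mul0r addr0.
  - by exists (g @^-1` P); rewrite ?setTI //; exact: g_open.
  - exists (g @^-1` P); rewrite ?setTI // -[X in closed X]setCK closedC.
    rewrite (_ : ~` _ = g @^-1` Q); first exact: g_open.
    apply/seteqP; split=> t /=; first by case: (PQ (g t)).
    by move=> Qt Pt; have : (P `&` Q) (g t) by []; rewrite PQ0.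
by move/seteqP => [_ /(_ 1 I)]; rewrite /= /g mul1r subrKC.
Qed.

(** Unlike in [pole_at], [n] may be 0 and [h] may vanish at [z0], so that products and differences
    keep this form. *)
Definition meromorphic_at f z0 := exists h (n : nat),
  analytic_at h z0 /\ punctured [set z | f z = h z / (z - z0) ^+ n] z0.

Lemma analytic_meromorphic_at f z0 : analytic_at f z0 -> meromorphic_at f z0.
Proof.
move=> fz; exists f, 0%N; split=> //; exists 1 => // w _.
by rewrite /= expr0 invr1 mulr1.
Qed.

Lemma meromorphic_atP f z0 : analytic_at f z0 \/ pole_at f z0 -> meromorphic_at f z0.
Proof.
case=> [|[h [n [r [hz _ _ r0 fh]]]]]; first exact: analytic_meromorphic_at.
by exists h, n; split=> //; apply/puncturedP; exists r.
Qed.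

Lemma punctured_sub A B z0 : A `<=` B -> punctured A z0 -> punctured B z0.
Proof. by move=> AB [d d0 Ad]; exists d => // w /Ad /AB. Qed.

Lemma punctured_neq z0 : punctured [set z | z - z0 != 0] z0.
Proof. by exists 1 => // w /andP[]; rewrite /= addrAC subrr add0r -cabs_gt0. Qed.

Lemma meromorphic_at_mul f h z0 : meromorphic_at f z0 -> meromorphic_at h z0 ->
  meromorphic_at (fun z => f z * h z) z0.
Proof.
case=> f1 [n [f1z fE]] [h1 [k [h1z hE]]].
exists (fun z => f1 z * h1 z), (n + k)%N; split; first exact: analytic_mul.
apply: punctured_sub (puncturedI _ _ _ fE hE) => z [/= -> ->].
by rewrite exprD invfM mulrACA.
Qed.

Lemma meromorphic_at_sub f h z0 : meromorphic_at f z0 -> meromorphic_at h z0 ->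
  meromorphic_at (fun z => f z - h z) z0.
Proof.
case=> f1 [n [f1z fE]] [h1 [k [h1z hE]]].
exists (fun z => f1 z * (z - z0) ^+ k - h1 z * (z - z0) ^+ n), (n + k)%N; split.
  apply: analytic_sub; [apply: (analytic_mul _ _ _ f1z)|apply: (analytic_mul _ _ _ h1z)];
    exact: analytic_Xn.
apply: punctured_sub (puncturedI _ _ _ (punctured_neq z0) (puncturedI _ _ _ fE hE)).
move=> z [/= z0z [-> ->]]; rewrite exprD.
have := expf_neq0 n z0z; have := expf_neq0 k z0z.
move: (_ ^+ n) (_ ^+ k) => u v v0 u0.
by field; rewrite u0 v0.
Qed.

Lemma meromorphic_at_prod (I : Type) (s : seq I) (f : I -> C -> C) z0 :
  (forall i, meromorphic_at (f i) z0) ->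
  meromorphic_at (fun z => \prod_(i <- s) f i z) z0.
Proof.
move=> fi; elim: s => [|i s IH].
  under eq_fun do rewrite big_nil.
  exact/analytic_meromorphic_at/(analytic_Xn z0 0).
by under eq_fun do rewrite big_cons; exact: meromorphic_at_mul.
Qed.

Lemma meromorphic_at_isolated f z0 : meromorphic_at f z0 ->
  punctured [set z | f z = 0] z0 \/ punctured [set z | f z != 0] z0.
Proof.
case=> h [n [/analytic_isolated_zeros hz fE]].
have nz := punctured_neq z0.
case: hz => -[d d0 hd]; [left|right].
  apply: (@punctured_sub ([set z | f z = h z / (z - z0) ^+ n] `&` [set z | h z = 0])).
    by move=> z /= [-> ->]; rewrite mul0r.
  by apply: puncturedI fE _; exists d => // w /andP[_ /hd].
apply: (@punctured_sub ([set z | z - z0 != 0] `&`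
    ([set z | f z = h z / (z - z0) ^+ n] `&` [set z | h z != 0]))).
  by move=> z /= [z0z [-> hz]]; rewrite mulf_neq0 // invr_eq0 expf_neq0.
by apply: puncturedI nz _; apply: puncturedI fE _; exists d.
Qed.

Lemma meromorphic_identity f p : (forall z, meromorphic_at f z) ->
  punctured [set z | f z = 0] p -> forall s, punctured [set z | f z = 0] s.
Proof.
move=> fm fp s.
apply: (segment_induction (punctured [set z | f z = 0]) (punctured [set z | f z != 0]) p).
- by move=> z /punctured_near.
- by move=> z /punctured_near.
- by move=> z; exact/meromorphic_at_isolated/fm.
(* Two punctured discs around the same point have a common point. *)
- apply/seteqP; split=> // z [f0 f1].
  have [w [/= -> /eqP]] := punctured_nonempty _ _ (puncturedI _ _ _ f0 f1).
  by [].
- by [].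
Qed.

End Identity.

(** * Zeta functions *)

Section UnconditionalProducts.
Context {R : realType} {I : choiceType}.
Local Notation C := R[i].

Lemma cvg_prod_unique (f : I -> C) l k :
  Defs.cvg_prod f l -> Defs.cvg_prod f k -> l = k.
Proof.
move=> fl fk.
have FF := @fmap_proper_filter _ _ (fun J : {fset I} => \prod_(i : J) f (val i)) _
  (@totally_filter I).
exact: (@cvg_unique _ (@norm_hausdorff _ C^o) _ FF _ _ fl fk).
Qed.

Lemma cvg_prod_bigprod (J : Type) (s : seq J) (f : J -> I -> C) l :
  (forall j, Defs.cvg_prod (f j) (l j)) ->
  Defs.cvg_prod (fun i => \prod_(j <- s) f j i) (\prod_(j <- s) l j).
Proof.
move=> fl; rewrite /Defs.cvg_prod; under eq_fun do rewrite exchange_big.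
apply: (@cvg_big C^o) => [|| j _]; [exact: mul_continuous| |exact: fl].
exact: (@filter_filter _ _ (@totally_filter I)).
Qed.

End UnconditionalProducts.

Section SelbergZeta.
Context {R : realType} (lam : R).
Local Notation C := R[i].
Context {V : vectType C} (chi : PSL2 R -> 'End(V)) {m : nat} {W : 'I_m -> vectType C}.
Context (psi : forall j, PSL2 R -> 'End(W j)) (iota : forall j, 'Hom(W j, V)).
Hypothesis iota_sum : is_direct_sum lam chi psi iota.

Lemma euler_factor_direct_sum s g k : hecke lam g ->
  euler_factor chi s g k = \prod_j euler_factor (psi j) s g k.
Proof.
case: iota_sum => iota_bij chi_iota hg.
apply: (det_mxof_direct_sum _ _ _ _ _ _ iota_bij) => j w.
by do ! rewrite lfunE /=; rewrite chi_iota // [in RHS]linearB /= [in RHS]linearZ.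
Qed.

Lemma selberg_product_direct_sum s l (lj : 'I_m -> C) :
  selberg_product lam chi s l ->
  (forall j, selberg_product lam (psi j) s (lj j)) -> l = \prod_j lj j.
Proof.
move=> [P [PE Pl]] hj.
pose Q j := sval (cid (hj j)).
have QE j (c : prim_hyp_classes lam) g : val c g ->
    ccvg (fun n => \prod_(k < n) euler_factor (psi j) s g k) (Q j c).
  by rewrite /Q; case: cid => Pj [PjE ?] /=; exact: PjE.
have Ql j : Defs.cvg_prod (Q j) (lj j) by rewrite /Q; case: cid => Pj [].
(* Each class contains a representative, at which both inner products converge; limits are
   unique. *)
have PQ : P = fun c => \prod_j Q j c.
  apply/funext => c; have := set_valP c.
  case=> g [hg _ _ cE].
  have cg : val c g.
    by rewrite cE; exists 1%g; [exact: hecke_1|rewrite mul1g invg1 mulg1].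
  apply: (ccvg_unique _ _ _ (PE c g cg)).
  rewrite (_ : (fun n => _) =
      fun n => \prod_j \prod_(k < n) euler_factor (psi j) s g k).
    by apply: ccvg_prod => j; exact: QE.
  apply/funext => n; rewrite exchange_big; apply: eq_bigr => k _.
  exact: euler_factor_direct_sum.
apply: (cvg_prod_unique _ _ _ Pl); rewrite PQ; exact: cvg_prod_bigprod.
Qed.

Lemma selberg_zeta_direct_sum (Z : C -> C) (Zj : 'I_m -> C -> C) s :
  is_selberg_zeta lam chi Z -> (forall j, is_selberg_zeta lam (psi j) (Zj j)) ->
  (forall j, analytic_at (Zj j) s) ->
  analytic_at Z s /\ Z s = \prod_j Zj j s.
Proof.
move=> [Zm Zp] hj Zjs.
pose G z := \prod_j Zj j z.
have Gs : analytic_at G s by exact: analytic_prod.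
(* One unit to the right of the critical abscissa, so the unit disc around [p] lies in the
   half-plane of convergence. *)
pose p : C := (hausdorff_dim (limit_set lam) + 1)%:C.
have ZG : punctured [set z | Z z - G z = 0] s.
  apply: (meromorphic_identity _ p).
    move=> z; apply: meromorphic_at_sub; first exact: meromorphic_atP.
    by apply: meromorphic_at_prod => j; apply: meromorphic_atP; case: (hj j).
  exists 1 => // w /andP[_ w1] /=; apply/eqP; rewrite subr_eq0; apply/eqP.
  have pw : hausdorff_dim (limit_set lam) < complex.Re (p + w).
    rewrite raddfD /= -addrA ltrDl -ltrBlDl sub0r.
    by move: (le_lt_trans (ler_Re_cabs w) w1); rewrite ltr_norml => /andP[].
  apply: selberg_product_direct_sum; first exact: Zp.
  by move=> j; case: (hj j) => _; exact.
case: (Zm s) => [Zs|[h [n [r [hs hs0 n0 r0 Zh]]]]].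
  split; first exact: Zs.
  apply/eqP; rewrite -subr_eq0; apply/eqP.
  exact: (analytic_eq0 _ _ (analytic_sub _ _ _ Zs Gs) ZG).
(* At a pole, this difference vanishes off [s], hence also at [s]; there the second term is 0
   because [n] is positive, which contradicts [h s != 0]. *)
have hG : analytic_at (fun z => h z - G z * (z - s) ^+ n) s.
  apply: analytic_sub; first exact: hs.
  by apply: analytic_mul; [exact: Gs|exact: analytic_Xn].
have hG0 : punctured [set z | h z - G z * (z - s) ^+ n = 0] s.
  have Zhp : punctured [set z | Z z = h z / (z - s) ^+ n] s.
    by apply/puncturedP; exists r.
  apply: punctured_sub (puncturedI _ _ _ (punctured_neq s) (puncturedI _ _ _ ZG Zhp)).
  move=> z [/= zs [/eqP]]; rewrite subr_eq0 => /eqP <- ->.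
  by rewrite divfK ?subrr // expf_neq0.
have /eqP := analytic_eq0 _ _ hG hG0.
by rewrite subrr expr0n eqn0Ngt n0 mulr0 subr0 (negPf hs0).
Qed.

End SelbergZeta.

Theorem theorem6p1 (R : realType) (lam : R) (Hlam : hecke_parameter lam)
    (V : vectType R[i]) (form : {dot V for (@Num.conj R[i])})
    (chi : PSL2 R -> 'End(V)) (Hchi : is_unitary_representation lam form chi)
    (m : nat) (W : 'I_m -> vectType R[i])
    (psi : forall j : 'I_m, PSL2 R -> 'End(W j))
    (Hpsi : forall j : 'I_m, is_representation lam (psi j))
    (iota : forall j : 'I_m, 'Hom(W j, V))
    (Hsum : is_direct_sum lam chi psi iota) :
  [/\ forall (A : operator_matrix R) (s : R[i]), slow_operator lam A ->
        operator_decomposes (@opm_domain R A) s chi psi iota,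
      forall (A : operator_matrix R) (s : R[i]), fast_operator lam A ->
        forall D : 'I_(opm_size A) -> set R[i],
          (forall r, opm_domain r `<=` D r) ->
          operator_decomposes D s chi psi iota
    & forall (Z : R[i] -> R[i]) (Zj : 'I_m -> R[i] -> R[i]),
        is_selberg_zeta lam chi Z ->
        (forall j : 'I_m, is_selberg_zeta lam (psi j) (Zj j)) ->
        forall s : R[i], (forall j : 'I_m, analytic_at (Zj j) s) ->
          analytic_at Z s /\ Z s = \prod_(j < m) Zj j s].
Proof.
split=> [A s /slow_operator_hecke hA|A s /fast_operator_hecke hA D _|Z Zj hZ hZj s].
- exact: (operator_decomposes_hecke _ _ _ _ Hsum _ _ _ hA).
- exact: (operator_decomposes_hecke _ _ _ _ Hsum _ _ _ hA).
- exact: (selberg_zeta_direct_sum lam chi psi iota Hsum Z Zj s hZ hZj).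
Qed.
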